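(* Let $f=\sum_{i=0}^n a_ix^i\in\mathbb{Z}[x]$ with $n>0$, $a_n>0$, $a_0\neq0$ and $\gcd(a_0,\dots,a_n)=1$. If $f(1)=0$ and any other root $z$ of $f$ satisfies $|z|<1$, then $f\in\Phi_1$ if and only if there is an integer $\delta>0$ such that $f(x)/(x-1)\in\mathbb{Z}[x^\delta]$ and $f(x)(x^\delta-1)/(x-1)\in\Phi_0$.
   Context: For $h\in\mathbb{Z}[x]$, $\mathrm{lt}(h)$ is the leading term and $h^+,h^-\in\mathbb{N}[x]$ are the positive and negative parts, $h=h^+-h^-$ with no monomial occurring in both. $\Phi_0=\{h\in\mathbb{Z}[x]\mid \mathrm{lt}(h)=h^+\}$ and $\Phi_1=\{h\in\mathbb{Z}[x]\mid hg\in\Phi_0\text{ for some monic }g\in\mathbb{Z}[x]\}$. *)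

(* Defs.v *)
From HB Require Import structures.
From mathcomp Require Import all_boot all_order all_algebra.
From mathcomp Require Import reals.
From mathcomp Require Export complex.

Set Implicit Arguments.
Unset Strict Implicit.
Unset Printing Implicit Defensive.

Import Order.TTheory GRing.Theory Num.Theory.
Local Open Scope ring_scope.

(* lt(h); the convention lt(0) = 0 is built in. *)
Definition lead_term (h : {poly int}) : {poly int} :=
  lead_coef h *: 'X^((size h).-1).

(* h^+ and h^- are taken in Z[x] (with nonnegative coefficients) rather than
   in a separate type N[x], since h^+ is compared with lt(h) in Z[x]. *)
Definition pos_part (h : {poly int}) : {poly int} :=
  \poly_(i < size h) Num.max h`_i 0.

Definition neg_part (h : {poly int}) : {poly int} :=
  \poly_(i < size h) Num.max (- h`_i) 0.

Definition Phi0 (h : {poly int}) : Prop := lead_term h = pos_part h.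

Definition Phi1 (h : {poly int}) : Prop :=
  exists2 g : {poly int}, g \is monic & Phi0 (h * g).

(* q belongs to the subring Z[x^d] of Z[x]. *)
Definition in_ZXn (d : nat) (q : {poly int}) : Prop :=
  exists p : {poly int}, q = p \Po 'X^d.

Lemma coef_pos_part (h : {poly int}) i : (pos_part h)`_i = Num.max h`_i 0.
Proof.
by rewrite coef_poly; case: ltnP => // hi; rewrite nth_default // maxxx.
Qed.

Lemma coef_neg_part (h : {poly int}) i : (neg_part h)`_i = Num.max (- h`_i) 0.
Proof.
by rewrite coef_poly; case: ltnP => // hi; rewrite nth_default // oppr0 maxxx.
Qed.

Lemma pos_neg_partP (h : {poly int}) :
  [/\ h = pos_part h - neg_part h,
      forall i, 0 <= (pos_part h)`_i,
      forall i, 0 <= (neg_part h)`_i &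
      forall i, (pos_part h)`_i = 0 \/ (neg_part h)`_i = 0].
Proof.
split=> [|i|i|i].
- apply/polyP => i; rewrite coefB coef_pos_part coef_neg_part.
  case: (lerP 0 h`_i) => h0; first by rewrite max_r ?subr0 // oppr_le0.
  by rewrite max_l ?oppr_ge0 ?ltW // sub0r opprK.
- by rewrite coef_pos_part le_max lexx orbT.
- by rewrite coef_neg_part le_max lexx orbT.
- rewrite coef_pos_part coef_neg_part.
  case: (lerP 0 h`_i) => h0; [right | by left].
  by rewrite max_r // oppr_le0.
Qed.

(* Since 'X - 1 is monic, the pseudo-quotient %/ over int is the exact
   quotient whenever 1 is a root. *)
Lemma divp_X1K (f : {poly int}) : f.[1] = 0 -> (f %/ ('X - 1)) * ('X - 1) = f.
Proof.
move=> /rootP /factor_theorem [q ->]; rewrite -polyC1.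
by rewrite Pdiv.IdomainMonic.mulpK ?monicXsubC.
Qed.

(* Main.v *)
(* Write f = (x - 1) q and h = f g in Phi_0 with g monic; one may assume
   g(0) != 0.  Let d be the gcd of the exponents occurring in h.  By the triangle
   inequality every root z of h with |z| >= 1 satisfies z^d = 1, and h'(1) > 0
   makes 1 a simple root.  So h = K(x^d) (x^d - 1) with K(1) != 0, while q has no
   root on the unit circle and hence is coprime to x^d - 1.  Thus
   (x - 1) g = (x^d - 1) g' and K(x^d) = q g'.  The monic integer polynomial g'
   has all its roots in the open unit disc and g'(0) != 0, so g' = 1, which gives
   q = K(x^d) and h = q (x^d - 1). *)
Require Import Defs.
From HB Require Import structures.
From mathcomp Require Import all_boot all_order all_algebra.
From mathcomp Require Import reals.

Set Implicit Arguments.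
Unset Strict Implicit.
Unset Printing Implicit Defensive.

Import Order.TTheory GRing.Theory Num.Theory.
Local Open Scope ring_scope.

Local Notation pC := (map_poly intr).

(** Compare coefficients: below the top index the left side is zero, and at the top index the
    equation reads [a = max a 0]. *)
Lemma Phi0P (h : {poly int}) :
  Phi0 h <->
  0 <= lead_coef h /\ (forall i, (i < (size h).-1)%N -> h`_i <= 0).
Proof.
rewrite /Phi0; split=> [/polyP e|[l0 hi]].
  split=> [|i lt_i].
    have := e (size h).-1.
    by rewrite coefZ coefXn eqxx mulr1 coef_pos_part => ->; rewrite le_max lexx orbT.
  have := e i; rewrite coefZ coefXn ltn_eqF // mulr0 coef_pos_part => {2}->.
  by rewrite le_max lexx.
apply/polyP=> i; rewrite coefZ coefXn coef_pos_part.
case: (ltngtP i (size h).-1) => [lt_i|gt_i|->].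
- by rewrite mulr0 max_r ?hi.
- by rewrite mulr0 nth_default ?maxxx //; case: (size h) gt_i.
- by rewrite mulr1 max_l.
Qed.

Lemma Phi0_mulX (h : {poly int}) : Phi0 (h * 'X) -> Phi0 h.
Proof.
have [->|hn0] := eqVneq h 0; first by rewrite mul0r.
move=> /Phi0P; rewrite lead_coefM lead_coefX mulr1 size_mulX //= => -[l0 hi].
apply/Phi0P; split=> // i lt_i.
by have := hi i.+1; rewrite coefMX /=; apply; case: (size h) lt_i.
Qed.

(** Powers of ['X] can be stripped from the multiplier one at a time without leaving [Phi0]. *)
Lemma Phi1_coef0 (f : {poly int}) :
  Phi1 f -> exists g : {poly int}, [/\ g \is monic, g`_0 != 0 & Phi0 (f * g)].
Proof.
case=> g; have [k] := ubnP (size g); elim: k g => // k IHk g lt_k mg fg0.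
have [g0|g0] := eqVneq g`_0 0; last by exists g.
have /factor_theorem [g1 eg] : root g 0 by rewrite rootE horner_coef0 g0.
rewrite subr0 in eg.
have mg1 : g1 \is monic by move: mg; rewrite eg monicMr ?monicX.
apply: (IHk g1) => //; last by apply: Phi0_mulX; rewrite -mulrA -eg.
by move: lt_k; rewrite eg size_mulX ?monic_neq0.
Qed.

(** Since [h.[1] = 0], the derivative at 1 equals h'(1) - m h(1), the sum of the (m - i)(-h_i). No
    term is negative, and the term i = 0 is positive. This makes 1 a simple root. *)
Lemma deriv_at1_gt0 (h : {poly int}) (m : nat) :
  size h = m.+1 -> (forall i, (i < m)%N -> h`_i <= 0) ->
  h.[1] = 0 -> h`_0 != 0 -> 0 < h^`().[1].
Proof.
move=> sh hneg; rewrite horner_coef sh.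
under eq_bigr do rewrite expr1n mulr1.
move=> h1 h0.
have mgt0 : (0 < m)%N.
  by case: (posnP m) h1 h0 => // ->; rewrite big_ord1 => ->; rewrite eqxx.
have -> : h^`().[1] = \sum_(i < m.+1) (- h`_i) * (m - i)%:R.
  transitivity (\sum_(i < m.+1) h`_i * i%:R - (\sum_(i < m.+1) h`_i) * m%:R).
    rewrite h1 mul0r subr0 big_ord_recl mulr0 add0r /deriv sh /= horner_poly.
    by apply: eq_bigr => i _; rewrite expr1n mulr1 mulr_natr.
  rewrite big_distrl -sumrB; apply: eq_bigr => i _ /=.
  by rewrite natrB -1?ltnS // mulNr mulrBr opprB.
rewrite big_ord_recl ltr_wpDr //.
  apply: sumr_ge0 => i _; rewrite lift0.
  have [lt_i|le_i] := ltnP i.+1 m; last by rewrite (eqP le_i) mulr0.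
  by rewrite mulr_ge0 // oppr_ge0 hneg.
by rewrite mulr_gt0 ?ltr0n ?subn0 // oppr_gt0 lt_neqAle h0 hneg.
Qed.

(* On the unit circle [a z^m = sum c_i z^i] with [a = sum c_i] is the equality
   case of the triangle inequality. *)
Lemma Phi0_root_outside (C : numClosedFieldType) (h : {poly int}) (m : nat)
    (z : C) :
  size h = m.+1 -> (forall i, (i < m)%N -> h`_i <= 0) ->
  h.[1] = 0 -> h`_0 != 0 -> root (pC h) z -> 1 <= `|z| ->
  forall i, h`_i != 0 -> z ^+ i = 1.
Proof.
move=> sh hneg h1 h0 hz z1.
have mgt0 : (0 < m)%N.
  case: (posnP m) => // m0; move: h1 h0.
  by rewrite horner_coef sh m0 big_ord1 mulr1 => ->; rewrite eqxx.
pose c i : C := (- h`_i)%:~R.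
have c_ge0 i : (i < m)%N -> 0 <= c i by move=> /hneg; rewrite ler0z oppr_ge0.
have sumc : (h`_m)%:~R = \sum_(i < m) c i :> C.
  move: h1; rewrite horner_coef sh big_ord_recr /= expr1n mulr1 => /eqP.
  rewrite addrC addr_eq0 => /eqP ->; rewrite rmorphN rmorph_sum -sumrN.
  by apply: eq_bigr => i _; rewrite expr1n mulr1 /c rmorphN.
have sumz : (h`_m)%:~R * z ^+ m = \sum_(i < m) c i * z ^+ i.
  move: hz; rewrite rootE horner_coef size_map_inj_poly ?rmorph0 //; last first.
    exact: intr_inj.
  rewrite sh big_ord_recr /= coef_map /= addrC addr_eq0 => /eqP ->.
  rewrite -sumrN; apply: eq_bigr => i _.
  by rewrite coef_map /= /c rmorphN mulNr.
have a_gt0 : 0 < (h`_m)%:~R :> C.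
  rewrite sumc (bigD1 (Ordinal mgt0)) //= ltr_wpDr ?sumr_ge0 //.
    by move=> i _; apply: c_ge0.
  by rewrite ltr0z oppr_gt0 lt_neqAle h0 hneg.
have zE : `|z| = 1.
  apply/eqP; rewrite eq_le z1 andbT.
  (* Every exponent on the right of [sumz] is at most m - 1, and [|z|] is at least 1. *)
  have : (h`_m)%:~R * `|z| ^+ m <= (h`_m)%:~R * `|z| ^+ m.-1.
    rewrite -normrX -{1}(gtr0_norm a_gt0) -normrM sumz sumc big_distrl /=.
    apply: le_trans (ler_norm_sum _ _ _) _; apply: ler_sum => i _.
    rewrite normrM normrX (ger0_norm (c_ge0 _ _)) // ler_wpM2l ?c_ge0 //.
    by rewrite ler_weXn2l // -ltnS prednK.
  rewrite ler_pM2l // -{1}(prednK mgt0) exprS.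
  by rewrite ger_pMl // exprn_gt0 // (lt_le_trans ltr01).
have normF (i : 'I_m) : `|c i * z ^+ i| = c i.
  by rewrite normrM normrX zE expr1n mulr1 ger0_norm ?c_ge0.
have : `|\sum_(i < m) c i * z ^+ i| = \sum_(i < m) `|c i * z ^+ i|.
  rewrite -sumz normrM normrX zE expr1n mulr1 gtr0_norm // sumc.
  by apply: eq_bigr => i _; rewrite normF.
move=> /normC_sum_eq [t _ ht].
have zt i : (i < m)%N -> h`_i != 0 -> z ^+ i = t.
  move=> lt_i hi0; have := ht (Ordinal lt_i) isT; rewrite normF /=.
  by apply: mulfI; rewrite intr_eq0 oppr_eq0.
(* The nonzero constant term fixes the common direction: t = z^0. *)
have t1 : t = 1 by rewrite -(zt 0%N).
move=> i hi0; have [lt_i|] := ltnP i m; first by rewrite zt.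
rewrite leq_eqVlt => /predU1P [<-|gt_i]; last first.
  by rewrite nth_default ?sh ?eqxx in hi0.
(* The top index lies outside the sum; for it, [sumz] now reads a z^m = a. *)
apply: (mulfI (lt0r_neq0 a_gt0)); rewrite sumz mulr1 sumc.
by apply: eq_bigr => j _; rewrite ht // normF t1 mulr1.
Qed.

(** The value is 0 exactly when [h] is constant, hence the positivity conditions below. *)
Definition exponent_gcd (h : {poly int}) : nat :=
  \big[gcdn/0%N]_(i < size h | h`_i != 0) i.

Lemma exponent_gcd_dvd (h : {poly int}) i :
  h`_i != 0 -> (exponent_gcd h %| i)%N.
Proof.
move=> hi; have lt_i : (i < size h)%N.
  by rewrite ltnNge; apply: contra hi => ?; rewrite nth_default.
by have /dvdn_biggcdP/(_ (Ordinal lt_i) hi) := dvdnn (exponent_gcd h).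
Qed.

Lemma exponent_gcd_comp (h : {poly int}) :
  (0 < exponent_gcd h)%N -> exists H : {poly int}, h = H \Po 'X^(exponent_gcd h).
Proof.
set d := exponent_gcd h => d_gt0; exists (\poly_(j < size h) h`_(j * d)).
apply/polyP => i; rewrite coef_comp_poly_Xn //.
case: ifPn => [dvd_i|ndvd]; last first.
  by apply/eqP; apply: contraR ndvd; apply: exponent_gcd_dvd.
rewrite coef_poly divnK //; case: ltnP => // le_i.
by rewrite nth_default // (leq_trans le_i) ?leq_div.
Qed.

(** The exponent [m] shows that [z] is a root of unity; its order divides every exponent of [h],
    hence their gcd. *)
Lemma expr_exponent_gcd (R : nzRingType) (h : {poly int}) (m : nat) (z : R) :
  (0 < m)%N -> h`_m != 0 -> (forall i, h`_i != 0 -> z ^+ i = 1) ->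
  z ^+ exponent_gcd h = 1.
Proof.
move=> m_gt0 hm zi; have [k pk _] := prim_order_exists m_gt0 (zi m hm).
apply/eqP; rewrite -(prim_order_dvd pk); apply/dvdn_biggcdP => i hi.
by rewrite (prim_order_dvd pk) zi.
Qed.

(* The constant term is, up to sign, the product of the roots. *)
Lemma monic_int_roots_lt1 (C : numClosedFieldType) (g : {poly int}) :
  g \is monic -> g`_0 != 0 -> (forall z : C, root (pC g) z -> `|z| < 1) ->
  g = 1.
Proof.
move=> mg g0 rg.
have [r] := closed_field_poly_normal (pC g : {poly C}).
have -> : lead_coef (pC g : {poly C}) = 1.
  by rewrite lead_coef_map_inj ?(monicP mg) //; apply: intr_inj.
rewrite scale1r => er.
have rlt z : z \in r -> `|z| < 1.
  by move=> zr; apply: rg; rewrite er root_prod_XsubC.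
case: r er rlt => [|z r] er rlt.
  apply: (map_inj_poly (@intr_inj C)) => //.
  by rewrite er big_nil rmorph1.
have g0E : `|(g`_0)%:~R| = \prod_(w <- z :: r) `|w| :> C.
  rewrite -coef_map -horner_coef0 /= er horner_prod normr_prod.
  by apply: eq_bigr => w _; rewrite !hornerE normrN.
have : 1 <= `|(g`_0)%:~R| :> C.
  by rewrite -intr_norm ler1z -gtz0_ge1 normr_gt0.
rewrite g0E big_cons => ge1.
(* One root gives the strict inequality; the product over the others, possibly empty, is only
   bounded by 1. *)
suff lt1 : `|z| * \prod_(w <- r) `|w| < 1.
  by have := le_lt_trans ge1 lt1; rewrite ltxx.
apply: le_lt_trans (rlt z (mem_head _ _)); rewrite ler_piMr //.
have /andP[] // : 0 <= \prod_(w <- r) `|w| <= 1.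
rewrite big_seq; elim/big_ind: _ => [|x y /andP[? ?] /andP[? ?]|w wr].
- by rewrite ler01 lexx.
- by rewrite mulr_ge0 ?mulr_ile1.
- by rewrite normr_ge0 ltW // rlt // inE wr orbT.
Qed.

(** Division by a monic polynomial stays in Z[x]. Over [F], [d] divides the remainder, which is
    shorter than [d] and so vanishes. *)
Lemma dvdp_map_int (F : numFieldType) (d p : {poly int}) :
  d \is monic -> (pC d : {poly F}) %| pC p -> exists q, p = q * d.
Proof.
move=> md dvd; have ep := Pdiv.IdomainMonic.divp_eq md p.
have lt_r := ltn_modpN0 p (monic_neq0 md).
exists (p %/ d); move: (p %% d) (p %/ d) ep lt_r => r q ep lt_r.
suff r0 : r = 0 by rewrite ep r0 addr0.
apply/eqP; apply: contraTT lt_r => rn0; rewrite -leqNgt.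
have sizeC (s : {poly int}) : size (pC s : {poly F}) = size s.
  by apply: size_map_inj_poly => //; apply: intr_inj.
have dvd_r : (pC d : {poly F}) %| pC r.
  by move: dvd; rewrite ep rmorphD rmorphM /= dvdp_addr ?dvdp_mull.
have rn0F : (pC r : {poly F}) != 0 by rewrite -size_poly_gt0 sizeC size_poly_gt0.
by have := dvdp_leq rn0F dvd_r; rewrite !sizeC.
Qed.

Theorem lemma4p15 (R : realType) (n : nat) (f : {poly int})
  (hsize : size f = n.+1) (hn : (0 < n)%N)
  (hlead : 0 < f`_n) (h0 : f`_0 != 0)
  (hgcd : \big[gcdn/0%N]_(i < n.+1) absz f`_i = 1%N)
  (h1 : f.[1] = 0)
  (hroots : forall z : complex R,
      root (map_poly (fun a : int => a%:~R) f) z -> z != 1 -> `|z| < 1) :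
  Phi1 f <->
  exists delta : nat,
    [/\ (0 < delta)%N,
        in_ZXn delta (f %/ ('X - 1)) &
        Phi0 ((f * ('X^delta - 1)) %/ ('X - 1))].
Proof.
have mX1 : ('X - 1 : {poly int}) \is monic by rewrite -polyC1 monicXsubC.
have ef := divp_X1K h1; set q := f %/ ('X - 1) in ef *.
have divE p : (f * p) %/ ('X - 1) = q * p.
  by rewrite -ef -mulrA [_ * p]mulrC mulrA Pdiv.IdomainMonic.mulpK.
have monicD k : (0 < k)%N -> ('X^k - 1 : {poly int}) \is monic.
  by rewrite -polyC1; apply: monicXnsubC.
split; last first.
  case=> d [d_gt0 _]; rewrite divE => Phi0_qD.
  (* The multiplier is the quotient of x^d - 1 by x - 1. *)
  have /factor_theorem [g eg] : root ('X^d - 1 : {poly int}) 1.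
    by rewrite rootE !hornerE expr1n subrr.
  exists g; last by rewrite -ef -mulrA [_ * g]mulrC -eg.
  by have := monicD d d_gt0; rewrite eg monicMr ?monicXsubC.
move=> /Phi1_coef0 [g [mg g0 Phi0_fg]].
set h := f * g in Phi0_fg.
have fn0 : f != 0 by rewrite -size_poly_gt0 hsize.
have hh1 : h.[1] = 0 by rewrite hornerM h1 mul0r.
have hh0 : h`_0 != 0 by rewrite coef0M mulf_neq0.
have hneq0 : h != 0 by rewrite mulf_neq0 // monic_neq0.
have [m sh] : exists m, size h = m.+1.
  by exists (size h).-1; rewrite prednK ?size_poly_gt0.
have /Phi0P [_ hneg] := Phi0_fg; rewrite sh /= in hneg.
have m_gt0 : (0 < m)%N.
  case: (posnP m) => // m0; move: hh1 hh0.
  by rewrite horner_coef sh m0 big_ord1 mulr1 => ->; rewrite eqxx.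
have hm : h`_m != 0.
  by have := hneq0; rewrite -lead_coef_eq0 lead_coefE sh.
have h'1 := deriv_at1_gt0 sh hneg hh1 hh0.
set d := exponent_gcd h.
have d_gt0 : (0 < d)%N := dvdn_gt0 m_gt0 (exponent_gcd_dvd hm).
have mD := monicD d d_gt0.
have root_out (z : complex R) : root (pC h) z -> 1 <= `|z| -> z ^+ d = 1.
  move=> hz z1; apply: (expr_exponent_gcd m_gt0 hm).
  exact: (Phi0_root_outside sh hneg hh1 hh0 hz z1).
have eh : h = q * ('X - 1) * g by rewrite ef.
(* Here h'(1) = q(1) g(1). *)
have q1 : q.[1] != 0.
  apply: contraTneq h'1 => q10.
  by rewrite eh !derivM !hornerE q10 !(mul0r, mulr0, add0r, subrr, addr0) ltxx.
have [K eK] : exists K : {poly int}, h = (K \Po 'X^d) * ('X^d - 1).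
  have [H eH] := exponent_gcd_comp d_gt0.
  have /factor_theorem [K eHK] : root H 1.
    by rewrite rootE -hh1 eH horner_comp hornerXn expr1n.
  by exists K; rewrite eH eHK comp_polyM comp_polyB comp_polyX comp_polyC.
(* Here h'(1) = d K(1). *)
have K1 : K.[1] != 0.
  apply: contraTneq h'1 => K10.
  by rewrite eK derivM hornerD !hornerM horner_comp !hornerE !expr1n
             K10 subrr mulr0 mul0r addr0 ltxx.
have [g' eg'] : exists g', ('X - 1) * g = g' * ('X^d - 1).
  apply: (@dvdp_map_int (complex R)) => //.
  (* A root of x^d - 1 is either 1, where [q1] applies, or another point of the unit circle, where
     [f] has no root. *)
  have cop : coprimep (pC ('X^d - 1) : {poly complex R}) (pC q).
    apply: Pdiv.ClosedField.root_coprimep => z.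
    rewrite rmorphB /= map_polyXn rmorph1 rootE !hornerE subr_eq0.
    move=> /eqP zd; have [->|zn1] := eqVneq z 1.
      by rewrite -(rmorph1 intr) horner_map intr_eq0.
    have z1 : `|z| = 1.
      by apply/eqP; rewrite -(@pexpr_eq1 _ _ d) // -normrX zd normr1.
    apply/negP => qz0; have : `|z| < 1.
      by apply: hroots => //; rewrite -ef rmorphM /= rootM rootE qz0.
    by rewrite z1 ltxx.
  rewrite -(Gauss_dvdpr _ cop) -rmorphM mulrA /= -eh eK rmorphM /=.
  exact: dvdp_mull.
have Dn0 : 'X^d - 1 != 0 :> {poly int} by rewrite monic_neq0.
have KE : K \Po 'X^d = q * g'.
  by apply: (mulIf Dn0); rewrite -eK -mulrA -eg' mulrA.
have g'1 : g' = 1.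
  apply: (@monic_int_roots_lt1 (complex R)).
  - by have := monicMl g mX1; rewrite mg eg' monicMr.
  - apply: contraNneq hh0 => g'0.
    by rewrite eh -mulrA eg' !coef0M g'0 mul0r mulr0.
  (* A root z of [g'] with modulus at least 1 is a root of [h], so z^d = 1; evaluating K(x^d) = q g'
     at z then gives K(1) = 0. *)
  move=> z rz; rewrite real_ltNge ?real1 ?normr_real //; apply: contra K1 => z1.
  have zd : z ^+ d = 1.
    by apply: root_out => //; rewrite eh -mulrA eg' !rmorphM /= !rootM rz orbT.
  have : (pC (q * g')).[z] = 0 by rewrite rmorphM hornerM (eqP rz) mulr0.
  rewrite -KE map_comp_poly map_polyXn horner_comp hornerXn zd -(rmorph1 intr).
  by rewrite horner_map => /eqP; rewrite intr_eq0.
have eq : q = K \Po 'X^d by rewrite KE g'1 mulr1.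
exists d; split=> //; first by exists K.
by rewrite divE eq -eK.
Qed.
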